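(* Let $X$ be a locally compact (Hausdorff) topological group and $Y$ be any topological group. Every Haar-measurable homomorphism $h:X\to Y$ is continuous.
   Context: A function $f:X\to Y$ from a locally compact topological group $X$ to a topological space $Y$ is Haar-measurable if for every open set $U\subseteq Y$ the preimage $f^{-1}[U]$ belongs to the $\sigma$-algebra of sets measurable with respect to a Haar measure on $X$ (i.e. to the $\sigma$-algebra generated by the Borel sets and the Haar-null sets, where a set is Haar-null if it is contained in a Borel set of Haar measure zero). All topological spaces are Hausdorff. *)

(* Defs.v *)
From HB Require Import structures.
From mathcomp Require Import all_boot all_order all_algebra.
From mathcomp Require Import all_classical all_reals all_analysis.

Set Implicit Arguments.
Unset Strict Implicit.
Unset Printing Implicit Defensive.

Import Order.TTheory GRing.Theory Num.Theory.
Local Open Scope classical_set_scope.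

HB.mixin Record isTopGroup G of monoid.Group G & Topological G := {
  topgroup_mul_continuous :
    continuous (fun p : G * G => (monoid.mul p.1 p.2));
  topgroup_inv_continuous : continuous (@monoid.inv G)
}.

#[short(type="topGroupType")]
HB.structure Definition TopGroup :=
  { G of isTopGroup G & monoid.Group G & Topological G }.

Section Haar.
Variables (R : realType) (X : topGroupType).
Local Open Scope ereal_scope.

Definition Borel : set (set X) := <<s open >>.

Definition borel_measure (mu : set X -> \bar R) : Prop :=
  [/\ mu set0 = 0,
      (forall A, Borel A -> 0 <= mu A) &
      (forall F : nat -> set X, (forall n, Borel (F n)) ->
         trivIset setT F ->
         (fun n => \sum_(0 <= i < n) mu (F i)) @ \oo --> mu (\bigcup_n F n))].

(** A Radon measure (Folland's convention): a Borel measure that is finite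
    on compact sets, outer regular on Borel sets and inner regular on open
    sets. *)
Definition radon_measure (mu : set X -> \bar R) : Prop :=
  [/\ borel_measure mu,
      (forall K, compact K -> mu K < +oo),
      (forall A, Borel A ->
         mu A = ereal_inf [set mu U | U in [set U | open U /\ A `<=` U]]) &
      (forall U, open U ->
         mu U = ereal_sup [set mu K | K in [set K | compact K /\ K `<=` U]])].

Definition haar_measure (mu : set X -> \bar R) : Prop :=
  [/\ radon_measure mu,
      (forall (g : X) A, Borel A ->
         mu [set monoid.mul g x | x in A] = mu A) &
      exists2 A, Borel A & mu A != 0].

Definition mu_null (mu : set X -> \bar R) (N : set X) : Prop :=
  exists2 B, Borel B /\ N `<=` B & mu B = 0.

Definition mu_measurable_set (mu : set X -> \bar R) : set (set X) :=
  <<s Borel `|` mu_null mu >>.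

End Haar.

Definition haar_measurable (R : realType) (X : topGroupType)
    (Y : topologicalType) (f : X -> Y) : Prop :=
  exists2 mu : set X -> \bar R, haar_measure mu &
    forall U : set Y, open U -> mu_measurable_set mu (f @^-1` U).

(* Main.v *)
(* If h @^-1` W0 is non-null for every neighbourhood W0 of 1, Steinhaus' theorem
   makes h continuous.  Otherwise some A = h @^-1` W0 is (locally) null although
   S A is measurable for every set S of translations.

   Cutting W0 into a chain of neighbourhoods and well-ordering the group, as in
   Stone's theorem on the paracompactness of metric spaces, the translates of A
   can be disjointified: a non-null set F carries a map f to X such that every
   preimage of f is measurable and z \in f z A.  Cover A by open sets O_n of
   measure 1/n.  The translation action on the classes of the O_n modulo null
   sets is continuous, so a compact set L of translations is split by countably
   many sets into pieces S on which s O_n is constant modulo null sets.  By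
   tau-additivity S O_n has the measure of O_n, so S A is null.  Hence f induces
   psi : F -> 2^nat with null fibres and all preimages measurable.

   Such a psi cannot exist on a set of positive finite Radon measure.
   Well-order 2^nat and shrink F so that all proper initial segments have null
   preimage; by Lusin's theorem each of them has a small hull which is a union of cylinders, that is, a hull coded
   by a set of finite bit sequences, and Fubini's theorem contradicts
   Sierpinski's paradoxical decomposition of the square. *)

Require Import Defs.
From HB Require Import structures.
From mathcomp Require Import all_boot all_order all_algebra.
From mathcomp Require Import wochoice finmap.
From mathcomp Require Import all_classical all_reals all_analysis.
From mathcomp Require Import measurable_realfun.

Set Implicit Arguments.
Unset Strict Implicit.
Unset Printing Implicit Defensive.

Import Order.TTheory GRing.Theory Num.Theory.
Local Open Scope classical_set_scope.
Local Open Scope ring_scope.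

(** The measure of [A] is integrated in both orders: one gives at most [e * nu setT], the other at
    least the square of [nu setT]. With [e] half the total mass this becomes Sierpinski's
    contradiction. *)
Lemma sections_mass_le d (U : measurableType d) (R : realType)
    (nu : {finite_measure set U -> \bar R}) (A : set (U * U)) (F : set U)
    (e : R) :
  measurable A -> measurable F -> nu F = nu setT ->
  (forall x, nu (xsection A x) <= e%:E)%E ->
  (forall y, F y -> nu setT <= nu (ysection A y))%E ->
  (nu setT * nu setT <= e%:E * nu setT)%E.
Proof.
move=> mA mF FT xA yA.
have e0 : (0 <= e%:E)%E by apply: le_trans (xA point); exact: measure_ge0.
have mx : measurable_fun setT (nu \o xsection A : U -> \bar R).
  exact: measurable_fun_xsection.
have my : measurable_fun setT (nu \o ysection A : U -> \bar R).
  exact: measurable_fun_ysection.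
have := @indic_fubini_tonelli _ _ U U R nu nu A mA.
rewrite indic_fubini_tonelli_FE// indic_fubini_tonelli_GE// => eqI.
apply: (@le_trans _ _ (\int[nu]_x (nu \o xsection A) x)%E); last first.
  rewrite -integral_cst//.
  by apply: ge0_le_integral => // x _; exact: xA.
rewrite eqI; apply: (@le_trans _ _ (\int[nu]_(y in F) (nu \o ysection A) y)%E).
  rewrite -[X in (_ * X <= _)%E]FT -integral_cst//.
  apply: ge0_le_integral => //.
  exact: measurable_funS my.
exact: ge0_subset_integral.
Qed.

(** * Measurable maps to the Cantor space with all preimages measurable *)

Section InnerRegular.
Variables (R : realType) (T : ptopologicalType).
Variable m : {outer_measure set T -> \bar R}.
Local Open Scope ereal_scope.

Definition inner_regular := forall (E : set T) (e : R),
  m.-caratheodory E -> m E < +oo -> (0 < e)%R ->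
  exists K, [/\ compact K, K `<=` E & m (E `\` K) <= e%:E].

Hypothesis hT : hausdorff_space T.
Hypothesis regm : inner_regular.

(** Lusin's theorem for the map into the Cantor space with coordinates [P k]: on [K] each [P k] is
    relatively clopen, because it and its complement are cut down to disjoint compact sets. *)
Lemma lusin_separation (F : set T) (P : nat -> set T) (e : R) :
  m.-caratheodory F -> m F < +oo -> (forall k, m.-caratheodory (P k)) ->
  (0 < e)%R ->
  exists K, [/\ compact K, K `<=` F, m (F `\` K) <= e%:E &
    forall k, closed (K `&` P k) /\ closed (K `\` P k)].
Proof.
move=> mF Foo mP e0.
(* Each [k] pays for two inner approximations, of [P k] and of its complement in [F], hence the
   extra factor 1/2. *)
have dlt0 k : (0 < e / (2 ^ k.+1)%:R / 2)%R.
  by rewrite !divr_gt0// ltr0n expn_gt0.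
have inn (E : set T) k : m.-caratheodory E -> E `<=` F ->
    exists K, [/\ compact K, K `<=` E &
      m (E `\` K) <= (e / (2 ^ k.+1)%:R / 2)%:E].
  move=> mE EF; apply: regm => //.
  by apply: le_lt_trans Foo; exact: le_outer_measure.
have /choice[K1 hK1] k : exists K, [/\ compact K, K `<=` F `&` P k &
      m ((F `&` P k) `\` K) <= (e / (2 ^ k.+1)%:R / 2)%:E].
  apply: inn; last exact: subIsetl.
  exact: caratheodory_measurable_setI.
have /choice[K0 hK0] k : exists K, [/\ compact K, K `<=` F `\` P k &
      m ((F `\` P k) `\` K) <= (e / (2 ^ k.+1)%:R / 2)%:E].
  apply: inn; last exact: subDsetl.
  exact: caratheodory_measurable_setD.
pose Q k := K1 k `|` K0 k.
have cK1 k : closed (K1 k) by apply: compact_closed => //; case: (hK1 k).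
have cK0 k : closed (K0 k) by apply: compact_closed => //; case: (hK0 k).
have cQ k : closed (Q k) by exact: closedU.
have QF k : Q k `<=` F.
  move=> x [] kx; first by case: (hK1 k) => _ /(_ x kx)[].
  by case: (hK0 k) => _ /(_ x kx)[].
pose K := \bigcap_k Q k.
have cK : closed K by apply: closed_bigI => k _; exact: cQ.
have KQ k : K `<=` Q k by move=> x; exact.
exists K; split.
- apply: (subclosed_compact cK _ (KQ 0%N)).
  by apply: compactU; [case: (hK1 0%N)|case: (hK0 0%N)].
- by apply: subset_trans (KQ 0%N) _; exact: QF.
- have -> : F `\` K = \bigcup_k (F `\` Q k).
    apply/seteqP; split=> x.
      move=> [Fx nK]; apply: contrapT => h; apply: nK => k _.
      by apply: contrapT => nQ; apply: h; exists k.
    by move=> [k _ [Fx nQ]]; split => // /(KQ k).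
  apply: le_trans (outer_measure_sigma_subadditive m _) _.
  apply: le_trans (epsilon_trick0 xpredT (ltW e0)).
  apply: lee_nneseries => [k _ _|k _]; first exact: outer_measure_ge0.
  rewrite [X in _ <= X%:E]splitr EFinD.
  have sub : F `\` Q k `<=` ((F `&` P k) `\` K1 k) `|` ((F `\` P k) `\` K0 k).
    move=> x [Fx nQ]; have [Px|nPx] := pselect (P k x).
      by left; split => // h; apply: nQ; left.
    by right; split => // h; apply: nQ; right.
  apply: le_trans (le_outer_measure m _ _ sub) _.
  apply: le_trans (outer_measureU2 m _ _) _.
  by apply: leeD; [case: (hK1 k)|case: (hK0 k)].
move=> k; split.
- suff -> : K `&` P k = K `&` K1 k by exact: closedI.
  apply/seteqP; split=> x [Kx]; last by case: (hK1 k) => _ + _ => /[apply] -[].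
  move=> Px; split => //; case: (KQ k x Kx) => //.
  by case: (hK0 k) => _ + _ => /[apply] -[].
- suff -> : K `\` P k = K `&` K0 k by exact: closedI.
  apply/seteqP; split=> x [Kx]; last by case: (hK0 k) => _ + _ => /[apply] -[].
  move=> nPx; split => //; case: (KQ k x Kx) => //.
  by case: (hK1 k) => _ + _ => /[apply] -[].
Qed.

Section TotalImage.
Variables (F : set T) (psi : T -> nat -> bool).
Hypothesis Foo : m F < +oo.
Hypothesis mpsi : forall P, m.-caratheodory (F `&` psi @^-1` P).

Let mF : m.-caratheodory F.
Proof. by have := mpsi setT; rewrite preimage_setT setIT. Qed.

(** By Lusin, [psi] is continuous on a compact [K] nearly exhausting the part of [F] mapped outside
    [Z]. Its image is closed and misses [Z], and the complement of that image is a union of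
    cylinders. *)
Lemma cylinder_hull (Z : set (nat -> bool)) (e : R) :
  m (F `&` psi @^-1` Z) = 0 -> (0 < e)%R ->
  exists J : set (seq bool), (forall z, Z z -> exists n, J (mkseq z n)) /\
    m (F `&` [set x | exists n, J (mkseq (psi x) n)]) <= e%:E.
Proof.
move=> Z0 e0; pose F1 := F `&` psi @^-1` (~` Z).
have F1F : F1 `<=` F by exact: subIsetl.
have F1oo : m F1 < +oo by apply: le_lt_trans Foo; exact: le_outer_measure.
have [K [cK KF1 mK clK]] := lusin_separation (mpsi _ : m.-caratheodory F1) F1oo
  (fun k => mpsi [set c | c k]) e0.
have KF : K `<=` F by exact: subset_trans F1F.
(* The words that are not a prefix of any point of the image of [K]. *)
pose J := [set s : seq bool | forall x, K x -> mkseq (psi x) (size s) <> s].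
exists J; split; last first.
  have sub : F `&` [set x | exists n, J (mkseq (psi x) n)] `<=`
      (F1 `\` K) `|` (F `&` psi @^-1` Z).
    move=> x [Fx [n Jx]]; have [Zx|nZx] := pselect (Z (psi x)); [by right|left].
    by split => // Kx; apply: (Jx x Kx); rewrite size_mkseq.
  apply: le_trans (le_outer_measure m _ _ sub) _.
  apply: le_trans (outer_measureU2 m _ _) _.
  by rewrite Z0 adde0.
move=> z Zz; apply: contrapT => nJ.
have hx n : exists2 x, K x & mkseq (psi x) n = mkseq z n.
  apply: contrapT => nx; apply: nJ; exists n => x Kx; rewrite size_mkseq => xz.
  by apply: nx; exists x.
(* If every prefix of [z] occurs in the image of [K], compactness yields a point of [K] mapped to
   [z] itself. *)
pose C k := K `&` [set x | psi x k = z k].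
have cC k : closed (C k).
  have [c1 c0] := clK k; rewrite /C; case zk: (z k).
    suff <- : K `&` (F `&` psi @^-1` [set c | c k]) =
        K `&` [set x | psi x k = true] by [].
    apply/seteqP; split=> x /= [Kx]; first by move=> [_ ->].
    by move=> ->; split => //; split => //; exact: KF.
  suff <- : K `\` (F `&` psi @^-1` [set c | c k]) =
      K `&` [set x | psi x k = false] by [].
  apply/seteqP; split=> x /= [Kx]; last first.
    by move=> px; split => // -[_]; rewrite px.
  move=> npx; split => //; apply/negP => px; apply: npx.
  by split => //; exact: KF.
have : \bigcap_(k in [set: nat]) C k !=set0.
  move: (cK); rewrite compact_In0 => /(_ nat setT C); apply.
    exists C => // k _; apply/seteqP; split=> x; last by case.
    by move=> [Kx ?]; split => //; split.
  move=> D _; pose N := (\max_(i <- D) i).+1.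
  have [x Kx xz] := hx N; exists x => k kD; split => //=.
  have kN : (k < N)%N.
    rewrite ltnS.
    exact: (@leq_bigmax_seq _ (enum_fset D) xpredT id k kD isT).
  by have := congr1 (nth false ^~ k) xz; rewrite /= !nth_mkseq.
move=> [x Cx]; have [Kx _] := Cx 0%N I.
have [_] := KF1 x Kx; apply; rewrite /= (_ : psi x = z)//.
by apply/funext => k; case: (Cx k I).
Qed.

(* The pairs (x, y) such that the hull chosen for the initial segment below
   psi x contains psi y form a countable union of rectangles, since hulls are
   coded by subsets of a countable set. *)
Lemma null_of_null_initial_segments (le : rel (nat -> bool)) :
  total le ->
  (forall x, F x -> m (F `&` psi @^-1` [set c | le c (psi x)]) = 0) ->
  m F = 0.
Proof.
move=> tot ini; apply/eqP; rewrite -[_ == _]negbK; apply/negP => mF0.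
have mFfin : m F \is a fin_num by rewrite ge0_fin_numE// outer_measure_ge0.
pose r := fine (m F); have mFr : m F = r%:E by rewrite fineK.
have r0 : (0 < r)%R.
  by rewrite -lte_fin -mFr lt_neqAle eq_sym mF0 outer_measure_ge0.
have r20 : (0 < r / 2)%R by rewrite divr_gt0.
(* The hull depends only on the point [c] of the Cantor space, so conditions on [J (psi x)] are
   preimages under [psi], hence measurable. The default [set0] is never met on [F]. *)
have /choice[J hJ] c : exists J : set (seq bool),
    m (F `&` psi @^-1` [set c' | le c' c]) = 0 ->
    (forall z, le z c -> exists n, J (mkseq z n)) /\
    m (F `&` [set x | exists n, J (mkseq (psi x) n)]) <= (r / 2)%:E.
  have [c0|nc0] := pselect (m (F `&` psi @^-1` [set c' | le c' c]) = 0).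
    by have [J [? ?]] := cylinder_hull c0 r20; exists J.
  by exists set0.
pose U : measurableType _ := caratheodory_type m.
have Foo' : (m : {measure set U -> \bar R}) F < +oo by [].
have mF' : measurable (F : set U) by exact: mF.
pose nu := mfrestr mF' Foo'.
pose A : set (U * U) := \bigcup_(s in [set: seq bool])
  ((F `&` psi @^-1` [set c | J c s]) `*`
   (F `&` psi @^-1` [set c | exists n, mkseq c n = s])).
have mA : measurable A.
  apply: countable_bigcupT_measurable => [|s]; first exact: countableP.
  by apply: measurableX; exact: mpsi.
have AE x y : A (x, y) <->
    [/\ F x, F y & exists n, J (psi x) (mkseq (psi y) n)].
  split=> [[s _ [/= [Fx Js] [Fy [n ns]]]]|[Fx Fy [n Jn]]].
    by split => //; exists n; rewrite ns.
  by exists (mkseq (psi y) n) => //; split => /=; split => //; exists n.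
have nuT : nu setT = r%:E by rewrite /nu /mfrestr /mrestr setTI.
have nuF : nu F = r%:E by exact: (etrans (congr1 m (setIid F)) mFr).
have: nu setT * nu setT <= (r / 2)%:E * nu setT.
  apply: (@sections_mass_le _ U R nu A F) => //.
  - exact: etrans nuF (esym nuT).
  - move=> x; have [Fx|nFx] := pselect (F x); last first.
      suff -> : xsection A x = set0 by rewrite measure0 lee_fin ltW.
      by rewrite -subset0 => y; rewrite /xsection /= inE => /AE[].
    have [_] := hJ _ (ini x Fx); apply: le_trans; apply: le_outer_measure.
    by move=> y [+ Fy]; rewrite /xsection/= inE => /AE[].
  - move=> y Fy; apply: (@le_trans _ _ (m F)); first by rewrite mFr -nuT.
    (* By totality, either [psi y] lies below [psi x] and is caught by the hull chosen for [psi x],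
       or [x] lies in the null preimage of the segment below [psi y]. *)
    have sub : F `<=` (ysection A y `&` F) `|`
        (F `&` psi @^-1` [set c | le c (psi y)]).
      move=> x Fx; have [lyx|nlyx] := boolP (le (psi y) (psi x)).
        left; split => //; rewrite /ysection /= inE; apply/AE; split => //.
        by have [+ _] := hJ _ (ini x Fx); apply.
      right; split => //=.
      by have := tot (psi y) (psi x); rewrite (negbTE nlyx).
    apply: le_trans (le_outer_measure m _ _ sub) _.
    apply: le_trans (outer_measureU2 m _ _) _.
    by rewrite ini// adde0.
rewrite nuT -!EFinM lee_fin leNgt => /negP; apply.
by rewrite ltr_pM2r// ltr_pdivrMr// mulr_natr mulr2n ltrDl.
Qed.

End TotalImage.

(** If some strict initial segment has non-null preimage, [F] is replaced by the preimage of the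
    least such segment. Null fibres allow passing from strict to non-strict segments. *)
Lemma null_of_null_fibres (F : set T) (psi : T -> nat -> bool) :
  m F < +oo -> (forall P, m.-caratheodory (F `&` psi @^-1` P)) ->
  (forall c, m (F `&` psi @^-1` [set c]) = 0) -> m F = 0.
Proof.
move=> Foo mpsi fib.
have [le /= wole] := @well_ordering_principle (nat -> bool).
have tot : total le.
  by move=> x y; apply: (@wo_chainW _ le predT _ x y) => // A _; exact: wole.
have refl x : le x x by have := tot x x; rewrite orbb.
have anti : antisymmetric le.
  move=> x y; apply: (@wo_chain_antisymmetric _ le predT _ x y) => // A _.
  exact: wole.
pose seg a := [set c : nat -> bool | le c a /\ c <> a].
have segE a : F `&` psi @^-1` [set c | le c a] =
    (F `&` psi @^-1` seg a) `|` (F `&` psi @^-1` [set a]).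
  apply/seteqP; split=> x /=.
    by move=> [Fx lx]; have [->|n] := pselect (psi x = a); [right|left].
  by move=> [[Fx [? _]]|[Fx ->]].
have seg0 a : m (F `&` psi @^-1` seg a) = 0 ->
    m (F `&` psi @^-1` [set c | le c a]) = 0.
  move=> a0; apply/eqP; rewrite eq_le outer_measure_ge0 andbT segE.
  by apply: le_trans (outer_measureU2 m _ _) _; rewrite a0 fib adde0.
have [all0|] := pselect (forall a, m (F `&` psi @^-1` seg a) = 0).
  apply: (null_of_null_initial_segments Foo mpsi tot) => x Fx; exact: seg0.
move=> /existsNP[a0 na0].
pose B : {pred nat -> bool} := [pred a | `[< m (F `&` psi @^-1` seg a) <> 0 >]].
have /wole[a [[Ba mina] _]] : nonempty B.
  by exists a0; apply/asboolP.
(* It remains to refute this by showing the preimage of [seg a] null; segments strictly below [a]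
   are null by minimality. *)
have : m (F `&` psi @^-1` seg a) <> 0 by apply/asboolP; move: Ba.
case.
have FE P : F `&` psi @^-1` seg a `&` psi @^-1` P =
    F `&` psi @^-1` (seg a `&` P).
  by rewrite preimage_setI setIA.
apply: (@null_of_null_initial_segments _ psi _ _ le) => //.
- by apply: le_lt_trans Foo; apply: le_outer_measure; exact: subIsetl.
- by move=> P; rewrite FE; exact: mpsi.
move=> x [Fx [xa nxa]].
apply/eqP; rewrite eq_le outer_measure_ge0 andbT.
rewrite -(@seg0 (psi x)).
  by apply: le_outer_measure; rewrite FE; apply: setIS => y [].
apply: contrapT => nx0; apply: nxa; apply: anti; rewrite xa /=.
by apply: mina; apply/asboolP.
Qed.

End InnerRegular.

(** * Topological groups *)

(* Compactness by covers and generated sigma-algebras require pointed types. *)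
#[non_forgetful_inheritance]
HB.instance Definition _ (X : topGroupType) :=
  isPointed.Build (TopGroup.sort X) (monoid.one : X).

Section Translations.
Variable X : topGroupType.
Implicit Types (g x y : X) (A B U : set X).
Local Open Scope group_scope.

Lemma mulg_continuous g : continuous (fun x => g * x).
Proof.
move=> x; apply: (@continuous_comp _ _ _ (fun y => (g, y))
  (fun p : X * X => p.1 * p.2)); last exact: topgroup_mul_continuous.
by apply: cvg_pair; [exact: cvg_cst|exact: cvg_id].
Qed.

Definition translate g A := [set g * x | x in A].

Lemma translateE g A x : translate g A x <-> A (g^-1 * x).
Proof.
split=> [[y Ay <-]|Ax]; first by rewrite mulKg.
by exists (g^-1 * x) => //; rewrite mulVKg.
Qed.

Lemma translateK g A : translate g^-1 (translate g A) = A.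
Proof.
by apply/seteqP; split=> x; rewrite !translateE invgK mulKg.
Qed.

Lemma translateS g A B : A `<=` B -> translate g A `<=` translate g B.
Proof. by move=> AB x /translateE Ax; apply/translateE; exact: AB. Qed.

Lemma translateD g A B :
  translate g (A `\` B) = translate g A `\` translate g B.
Proof.
apply/seteqP; split=> x.
  by move=> /translateE[Ax nB]; split; rewrite translateE.
by move=> [/translateE Ax /translateE nB]; apply/translateE.
Qed.

Lemma translate_open g U : open U -> open (translate g U).
Proof.
move=> oU; have -> : translate g U = (fun x => g^-1 * x) @^-1` U.
  by apply/seteqP; split=> x; rewrite translateE.
by move/continuousP : (mulg_continuous (g := g^-1)); apply.
Qed.

(** The tube lemma for multiplication along {1} x [K]. *)
Lemma compact_mul_nbhs (K U : set X) : compact K -> open U -> K `<=` U ->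
  exists V, [/\ open V, V 1 & forall v k, V v -> K k -> U (v * k)].
Proof.
move=> cK oU KU.
have : nbhs (1 : X) [set v | K `<=` (fun k => U (v * k))].
  apply: ((compact_near_coveringP K).1 cK X (nbhs (1 : X))
    (fun v k => U (v * k))) => k Kk.
  have [[A B] /= [nA nB] AB] :
      nbhs ((1, k) : X * X) ((fun p : X * X => p.1 * p.2) @^-1` U).
    apply: (@topgroup_mul_continuous X (1, k)).
    by rewrite /= mul1g; apply: open_nbhs_nbhs; split => //; exact: KU.
  exists (B, A) => //= -[x v] /= [Bx Av].
  by apply: (AB (v, x)).
rewrite nbhsE => -[V [oV V1] VP].
by exists V; split => // v k Vv; exact: VP.
Qed.

Lemma compact_translates_cover (K V : set X) : compact K -> open V -> V 1 ->
  exists s : seq X, forall x, K x -> exists2 d, d \in s & translate d V x.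
Proof.
rewrite compact_cover => cK oV V1.
have [|x Kx|D _ KD] := cK X K (fun d => translate d V).
- by move=> d _; exact: translate_open.
- by exists x => //; apply/translateE; rewrite mulVg.
by exists (enum_fset D) => x /KD[d /= dD Vx]; exists d.
Qed.

End Translations.

Section GroupNeighbourhoods.
Variable X : topGroupType.
Local Open Scope group_scope.

Lemma group_nbhs_split (V : set X) : open V -> V 1 ->
  exists W, [/\ open W, W 1 &
    forall x y, W x -> W y -> [/\ V (x * y), V (x * y^-1) & V (x^-1 * y)]].
Proof.
move=> oV V1.
have split (f : X * X -> X) : continuous f -> f (1, 1) = 1 ->
    exists W, [/\ open W, W 1 & forall x y, W x -> W y -> V (f (x, y))].
  move=> cf f1.
  have [[A B] /= [nA nB] AB] : nbhs ((1, 1) : X * X) (f @^-1` V).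
    by apply: cf; rewrite f1; apply: open_nbhs_nbhs.
  have : nbhs (1 : X) (A `&` B) by exact: filterI.
  rewrite nbhsE => -[W [oW W1] WAB]; exists W; split => // x y Wx Wy.
  by apply: (AB (x, y)); split => /=; [case: (WAB x Wx)|case: (WAB y Wy)].
have mulc (u v : X * X -> X) : continuous u -> continuous v ->
    continuous (fun p => u p * v p).
  move=> cu cv p; apply: (@continuous_comp _ _ _ (fun p => (u p, v p))
    (fun q : X * X => q.1 * q.2)); last exact: topgroup_mul_continuous.
  by apply: cvg_pair; [exact: cu|exact: cv].
have invc (u : X * X -> X) : continuous u -> continuous (fun p => (u p)^-1).
  move=> cu p; apply: (@continuous_comp _ _ _ u (@monoid.inv X)).
    exact: cu.
  exact: topgroup_inv_continuous.
have c1 : continuous (@fst X X) by move=> p; exact: cvg_fst.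
have c2 : continuous (@snd X X) by move=> p; exact: cvg_snd.
have [|W1 [oW1 W11 hW1]] := split _ (mulc _ _ c1 c2); first by rewrite /= mulg1.
have [|W2 [oW2 W21 hW2]] := split _ (mulc _ _ c1 (invc _ c2)).
  by rewrite /= invg1 mulg1.
have [|W3 [oW3 W31 hW3]] := split _ (mulc _ _ (invc _ c1) c2).
  by rewrite /= invg1 mulg1.
exists (W1 `&` W2 `&` W3); split; first by apply: openI => //; exact: openI.
  by [].
move=> x y [[x1 x2] x3] [[y1 y2] y3].
by split; [exact: hW1|exact: hW2|exact: hW3].
Qed.

Lemma compact_quotients (L : set X) : compact L ->
  compact [set x | exists a b, [/\ L a, L b & x = a^-1 * b]].
Proof.
move=> cL; set Q := [set x | _].
have -> : Q = (fun p : X * X => p.1^-1 * p.2) @` (L `*` L).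
  apply/seteqP; split=> x; first by move=> [a [b [La Lb ->]]]; exists (a, b).
  by move=> [[a b] [/= La Lb] <-]; exists a, b.
apply: continuous_compact; last exact: compact_setX.
apply: continuous_subspaceT => p.
apply: (@continuous_comp _ _ _ (fun p : X * X => (p.1^-1, p.2))
  (fun q : X * X => q.1 * q.2)); last exact: topgroup_mul_continuous.
apply: cvg_pair; last exact: cvg_snd.
apply: (@continuous_comp _ _ _ fst (@monoid.inv X)); first exact: cvg_fst.
exact: topgroup_inv_continuous.
Qed.

End GroupNeighbourhoods.

(** * The outer measure of a Haar measure *)

Section RadonOuterMeasure.
Variables (R : realType) (X : topGroupType) (mu : set X -> \bar R).
Local Open Scope ereal_scope.

Lemma Borel_open (U : set X) : open U -> Borel U.
Proof. by move=> oU; exact: sub_sigma_algebra. Qed.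

Lemma Borel_compact (K : set X) : hausdorff_space X -> compact K -> Borel K.
Proof.
move=> hX cK; rewrite -[K]setCK.
have : @measurable _ (g_sigma_algebraType (@open X)) (~` K).
  by apply: Borel_open; apply: closed_openC; exact: compact_closed.
exact: measurableC.
Qed.

(** [mu] is constrained on Borel sets only, while a measure structure asks for nonnegativity on
    every set; hence the value 0 elsewhere. *)
Definition borel_part & borel_measure mu :
    set (g_sigma_algebraType (@open X)) -> \bar R :=
  fun A => if `[< Borel A >] then mu A else 0.

Section BorelPart.
Hypothesis bmu : borel_measure mu.

Let borel_partE A : Borel A -> borel_part bmu A = mu A.
Proof. by move=> bA; rewrite /borel_part asboolT. Qed.

Let borel_part0 : borel_part bmu set0 = 0.
Proof.
rewrite borel_partE; first by case: bmu.
exact: (@measurable0 _ (g_sigma_algebraType (@open X))).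
Qed.

Let borel_part_ge0 A : 0 <= borel_part bmu A.
Proof.
by rewrite /borel_part; case: asboolP => // bA; case: bmu => _ + _; apply.
Qed.

Let borel_part_sigma_additive : semi_sigma_additive (borel_part bmu).
Proof.
move=> F mF tF mUF; rewrite borel_partE//.
have -> : (fun n => \sum_(0 <= i < n) borel_part bmu (F i)) =
    (fun n => \sum_(0 <= i < n) mu (F i)).
  by apply/funext => n; apply: eq_bigr => i _; rewrite borel_partE//; exact: mF.
by case: bmu => _ _; apply.
Qed.

HB.instance Definition _ := isMeasure.Build _ _ _ (borel_part bmu)
  borel_part0 borel_part_ge0 borel_part_sigma_additive.

Definition borel_outer : {outer_measure set X -> \bar R} :=
  (mu_ext (borel_part bmu) :
    {outer_measure set (g_sigma_algebraType (@open X)) -> \bar R}).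

Lemma borel_outerE A : Borel A -> borel_outer A = mu A.
Proof. by move=> bA; rewrite -(borel_partE bA); exact: measurable_mu_extE. Qed.

Lemma borel_outer_caratheodory A : Borel A -> borel_outer.-caratheodory A.
Proof. by 
move=> bA; exact: (@caratheodory_measurable_mu_ext _ R
  (g_sigma_algebraType (@open X)) (borel_part bmu) A bA).
Qed.

Lemma borel_outer_hull (A : set X) (e : R) : (0 < e)%R ->
  exists B, [/\ Borel B, A `<=` B & borel_outer B <= borel_outer A + e%:E].
Proof.
move=> e0; have [Aoo|] := ltP (borel_outer A) +oo; last first.
  rewrite leye_eq => /eqP ->; exists setT; split => //.
    exact: (@measurableT _ (g_sigma_algebraType (@open X))).
  by rewrite addye// leey.
have Afin : borel_outer A \is a fin_num.
  by rewrite ge0_fin_numE// outer_measure_ge0.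
have [_ [F [mF AF] <-] FA] := lb_ereal_inf_adherent e0 Afin.
exists (\bigcup_k F k); split => //.
  exact: (@bigcupT_measurable _ (g_sigma_algebraType (@open X))).
apply: le_trans (outer_measure_sigma_subadditive borel_outer F) _.
apply: le_trans (ltW FA); apply: lee_nneseries => [k _ _|k _].
  exact: outer_measure_ge0.
have bF : Borel (F k) by exact: mF.
by rewrite borel_outerE// -(borel_partE bF).
Qed.

End BorelPart.
End RadonOuterMeasure.

(** * Regularity and translation invariance of the Haar outer measure *)

Section HaarOuterMeasure.
Variables (R : realType) (X : topGroupType) (mu : set X -> \bar R).
Hypothesis hX : hausdorff_space X.
Hypothesis hmu : haar_measure mu.
Local Open Scope ereal_scope.

Let bmu : borel_measure mu. Proof. by case: hmu => -[]. Qed.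

Definition haar_outer := borel_outer bmu.
Local Notation m := haar_outer.

Lemma haar_outerE A : Borel A -> m A = mu A. Proof. exact: borel_outerE. Qed.

Lemma haar_outer_open U : open U -> m.-caratheodory U.
Proof. by move=> oU; apply: borel_outer_caratheodory; exact: Borel_open. Qed.

Lemma haar_outer_compact K : compact K -> m.-caratheodory K.
Proof. by move=> cK; apply: borel_outer_caratheodory; exact: Borel_compact. Qed.

Lemma haar_outer_compact_lty K : compact K -> m K < +oo.
Proof.
move=> cK; rewrite haar_outerE; last exact: Borel_compact.
by case: hmu => -[_ + _ _] _ _; apply.
Qed.

Lemma null_caratheodory A : m A = 0 -> m.-caratheodory A.
Proof.
move=> A0; apply: le_caratheodory_measurable => B.
rewrite -[leRHS]add0e; apply: leeD; last exact: le_outer_measure.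
by rewrite -A0; apply: le_outer_measure; exact: subIsetr.
Qed.

(** The Caratheodory sets form a sigma-algebra containing the Borel sets and every set of outer
    measure zero. *)
Lemma mu_measurable_caratheodory A :
  mu_measurable_set mu A -> m.-caratheodory A.
Proof.
apply: smallest_sub.
  split.
  - exact: caratheodory_measurable_set0.
  - by move=> B mB; rewrite setTD; exact: caratheodory_measurable_setC.
  - exact: caratheodory_measurable_bigcup.
move=> B [bB|[C [bC BC] C0]]; first exact: borel_outer_caratheodory.
apply: null_caratheodory; apply/eqP; rewrite eq_le outer_measure_ge0 andbT.
by rewrite -C0 -(haar_outerE bC); exact: le_outer_measure.
Qed.

Lemma haar_outer_hull (A : set X) (e : R) : (0 < e)%R ->
  exists U, [/\ open U, A `<=` U & m U <= m A + e%:E].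
Proof.
move=> e0; have e20 : (0 < e / 2)%R by rewrite divr_gt0.
have [Aoo|] := ltP (m A) +oo; last first.
  rewrite leye_eq => /eqP ->; exists setT; split => //; first exact: openT.
  by rewrite addye// leey.
have Afin : m A \is a fin_num by rewrite ge0_fin_numE// outer_measure_ge0.
have [B [bB AB BA]] := borel_outer_hull bmu A e20.
have Boo : m B < +oo by rewrite (le_lt_trans BA)// ltey_eq fin_numD Afin.
have Bfin : m B \is a fin_num by rewrite ge0_fin_numE// outer_measure_ge0.
have muB : mu B = ereal_inf [set mu U | U in [set U | open U /\ B `<=` U]].
  by case: hmu => -[_ _ + _] _ _; apply.
have : ereal_inf [set mu U | U in [set U | open U /\ B `<=` U]] \is a fin_num.
  by rewrite -muB -haar_outerE.
move=> /(lb_ereal_inf_adherent e20)[_ [U [oU BU] <-]]; rewrite -muB => UB.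
exists U; split => //; first exact: subset_trans BU.
rewrite haar_outerE; last exact: Borel_open.
rewrite (le_trans (ltW UB))// -haar_outerE// [e in leRHS]splitr EFinD addeA.
by rewrite leeD2r.
Qed.

(** Inner regularity on open sets, in the form that gives tau-additivity: a compact subset of a
    union of open sets needs only finitely many of them. *)
Lemma haar_outer_le_compact (U : set X) (c : \bar R) : open U ->
  (forall K, compact K -> K `<=` U -> m K <= c) -> m U <= c.
Proof.
move=> oU Kc; rewrite haar_outerE; last exact: Borel_open.
have -> : mu U = ereal_sup [set mu K | K in [set K | compact K /\ K `<=` U]].
  by case: hmu => -[_ _ _ +] _ _; apply.
apply: ge_ereal_sup => _ [K [cK KU] <-].
by rewrite -haar_outerE; [exact: Kc|exact: Borel_compact].
Qed.

(** Invariance of [mu] on open sets passes to arbitrary sets through open hulls. *)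
Lemma haar_outer_translate g (A : set X) : m (translate g A) = m A.
Proof.
have opn (h : X) U : open U -> m (translate h U) = m U.
  move=> oU; have bU : Borel U by exact: Borel_open.
  have bhU : Borel (translate h U) by apply: Borel_open; exact: translate_open.
  rewrite !haar_outerE//.
  by case: hmu => _ + _; apply; exact: Borel_open.
have le (h : X) B : m (translate h B) <= m B.
  apply/lee_addgt0Pr => e e0; have [U [oU BU mU]] := haar_outer_hull B e0.
  apply: le_trans mU; rewrite -(opn h _ oU).
  by apply: le_outer_measure; exact: translateS.
apply/eqP; rewrite eq_le le /=.
by rewrite -{1}(translateK g A); exact: le.
Qed.

(** With [U] an open hull of [E], [V] an open hull of [U] minus [E], and [K] a large compact subset
    of [U], the compact set [K] minus [V] lies in [E]. *)
Lemma haar_outer_inner_regular : inner_regular m.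
Proof.
move=> E e mE Eoo e0.
(* One third is lost in [U] minus [K]; [V] costs two, one for the measure of [U] minus [E] and one
   for its hull. *)
have d0 : (0 < e / 3)%R by rewrite divr_gt0.
have fin (A : set X) : m A < +oo -> m A \is a fin_num.
  by move=> ?; rewrite ge0_fin_numE// outer_measure_ge0.
have [U [oU EU mU]] := haar_outer_hull E d0.
have Uoo : m U < +oo by rewrite (le_lt_trans mU)// ltey_eq fin_numD fin.
have mUE : m (U `\` E) <= (e / 3)%:E.
  have := mE U; rewrite (setIidr EU) => UE.
  by move: mU; rewrite UE leeD2lE//; exact: fin.
have [V [oV UV mV]] := haar_outer_hull (U `\` E) d0.
have [K [cK KU mK]] : exists K,
    [/\ compact K, K `<=` U & m U - (e / 3)%:E <= m K].
  apply: contrapT => nK; have : m U <= m U - (e / 3)%:E.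
    apply: haar_outer_le_compact => // K cK KU; apply/ltW; rewrite ltNge.
    by apply/negP => h; apply: nK; exists K.
  by rewrite -(fineK (fin _ Uoo)) -EFinB lee_fin lerBrDr gerDl leNgt d0.
have mUK : m (U `\` K) <= (e / 3)%:E.
  have UK := haar_outer_compact cK U.
  rewrite (setIidr KU) in UK.
  have Koo : m K < +oo by exact: haar_outer_compact_lty.
  by move: mK; rewrite UK leeBlDr// leeD2lE//; exact: fin.
exists (K `\` V); split.
- rewrite setDE; apply: compact_closedI => //; exact: open_closedC.
- move=> x [Kx nVx]; apply: contrapT => nEx; apply: nVx; apply: UV.
  by split => //; exact: KU.
have sub : E `\` (K `\` V) `<=` (U `\` K) `|` V.
  move=> x [Ex nK]; have [Vx|nVx] := pselect (V x); [by right|left].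
  by split; [exact: EU|move=> Kx; exact: nK].
apply: le_trans (le_outer_measure m _ _ sub) _.
apply: le_trans (outer_measureU2 m _ _) _.
have -> : e%:E = (e / 3)%:E + ((e / 3)%:E + (e / 3)%:E).
  rewrite -!EFinD; congr _%:E.
  by rewrite -!mulrDl -mulr2n -mulrS -[(e *+ 3)%R]mulr_natr mulfK.
by apply: leeD => //; apply: le_trans mV _; rewrite leeD2r.
Qed.

Lemma exists_compact_nonnull : exists2 L, compact L & m L <> 0.
Proof.
apply: contrapT => nL; case: hmu => _ _ [A bA]; case/eqP.
have T0 : m setT <= 0.
  apply: haar_outer_le_compact => [|K cK _]; first exact: openT.
  rewrite leNgt; apply/negP => K0; apply: nL; exists K => // K0'.
  by rewrite K0' ltxx in K0.
apply/eqP; rewrite eq_le -haar_outerE// outer_measure_ge0 andbT.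
by apply: le_trans T0; exact: le_outer_measure.
Qed.

End HaarOuterMeasure.

(** * Automatic continuity *)

Section Homomorphisms.
Variables (R : realType) (X : topGroupType) (mu : set X -> \bar R).
Hypothesis hX : hausdorff_space X.
Hypothesis hmu : haar_measure mu.
Local Open Scope ereal_scope.
Local Open Scope group_scope.
Local Notation m := (haar_outer hmu).

(** A compact [K] in [A] has an open hull [U] of measure less than twice that of [K]. If [v] is so
    close to 1 that [v K] stays in [U], then [K] and [v K] cannot be disjoint. *)
Lemma steinhaus (A : set X) :
  m.-caratheodory A -> (m A < +oo)%E -> m A <> 0%E ->
  exists V, [/\ open V, V 1 &
    forall v, V v -> exists a b, [/\ A a, A b & v = a * b^-1]].
Proof.
move=> mA Aoo A0.
have fin (B : set X) : (m B < +oo)%E -> m B \is a fin_num.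
  by move=> ?; rewrite ge0_fin_numE// outer_measure_ge0.
have gt0 (B : set X) : m B <> 0%E -> (m B < +oo)%E -> (0 < fine (m B))%R.
  move=> B0 Boo; rewrite fine_gt0// Boo andbT lt_neqAle eq_sym.
  by rewrite outer_measure_ge0 andbT; apply/eqP.
have a0 : (0 < fine (m A) / 2)%R by rewrite divr_gt0// gt0.
have [K [cK KA AK]] := haar_outer_inner_regular hX mA Aoo a0.
have Koo : (m K < +oo)%E by apply: le_lt_trans Aoo; exact: le_outer_measure.
have K0 : m K <> 0%E.
  move=> K0; have : (m A <= m K + m (A `\` K))%E.
    by apply: le_trans (outer_measureU2 m _ _); apply: le_outer_measure => x Ax;
      have [|] := pselect (K x); [left|right].
  rewrite K0 add0e => /le_trans/(_ AK); rewrite -{1}(fineK (fin _ Aoo)) lee_fin.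
  by rewrite leNgt ltr_pdivrMr// mulr_natr mulr2n ltrDl gt0.
have k0 : (0 < fine (m K) / 2)%R by rewrite divr_gt0// gt0.
have [U [oU KU mU]] := haar_outer_hull hmu K k0.
have [V [oV V1 VKU]] := compact_mul_nbhs cK oU KU.
exists V; split => // v Vv; apply: contrapT => nv.
have disj : translate v K `<=` U `&` ~` K.
  move=> x /translateE Kx; split.
    by rewrite -(mulVKg v x); exact: VKU.
  move=> Kx'; apply: nv; exists x, (v^-1 * x); split; [exact: KA|exact: KA|].
  by rewrite invgM invgK mulVKg.
have := haar_outer_compact hX hmu cK U; rewrite (setIidr KU) => UK.
have : (m K + m K <= m U)%E.
  rewrite UK leeD2lE ?fin// -{1}(haar_outer_translate hmu v K).
  exact: le_outer_measure.
move=> /le_trans/(_ mU); rewrite leeD2lE ?fin// -{1}(fineK (fin _ Koo)) lee_fin.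
by rewrite leNgt ltr_pdivrMr// mulr_natr mulr2n ltrDl gt0.
Qed.

Lemma null_bigcup_seq (s : seq X) (N : X -> set X) :
  (forall d, d \in s -> m (N d) = 0%E) ->
  m [set x | exists2 d, d \in s & N d x] = 0%E.
Proof.
elim: s => [|d s IH] Ns.
  by rewrite (_ : [set x | _] = set0)// -subset0 => x [].
apply/eqP; rewrite eq_le outer_measure_ge0 andbT.
have sub : [set x | exists2 d0, d0 \in d :: s & N d0 x] `<=`
    N d `|` [set x | exists2 d0, d0 \in s & N d0 x].
  move=> x [d0]; rewrite inE => /orP[/eqP ->|ds] Nx; first by left.
  by right; exists d0.
apply: le_trans (le_outer_measure m _ _ sub) _.
apply: le_trans (outer_measureU2 m _ _) _.
rewrite Ns ?mem_head// IH ?adde0// => d0 ds.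
by rewrite Ns// inE ds orbT.
Qed.

(* Although S may be uncountable, a compact subset of the union
   meets only finitely many of the translates. *)
Lemma essentially_equal_translates (O : set X) (s0 : X) (S : set X) :
  open O -> (forall s, S s -> m (translate s O `\` translate s0 O) = 0%E) ->
  (m (\bigcup_(s in S) translate s O) <= m O)%E.
Proof.
move=> oO S0; apply: haar_outer_le_compact => //.
  by apply: bigcup_open => s _; exact: translate_open.
move=> K; rewrite compact_cover => cK KS.
have [|//|D DS KD] := cK X S (fun s => translate s O).
  by move=> s _; exact: translate_open.
rewrite -(haar_outer_translate hmu s0 O).
pose N := [set x | exists2 d, d \in enum_fset D &
  (translate d O `\` translate s0 O) x].
have N0 : m N = 0%E.
  by apply: null_bigcup_seq => d dD; apply: S0; have := DS d dD; rewrite inE.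
have sub : K `<=` translate s0 O `|` N.
  move=> x /KD[d /= dD Ox].
  by have [?|nO] := pselect (translate s0 O x); [left|right; exists d].
apply: le_trans (le_outer_measure m _ _ sub) _.
apply: le_trans (outer_measureU2 m _ _) _.
by rewrite N0 adde0.
Qed.

(* If K is a compact subset of O n of almost full measure and t^-1 s maps K into
   O n, then m (translate s (O n) `\` translate t (O n)) is small. *)
Lemma countable_translate_code (L : set X) (O : nat -> set X) :
  compact L -> (forall n, open (O n)) -> (forall n, m (O n) < +oo)%E ->
  exists C : nat -> set X, forall s t, L s -> (forall k, C k s -> C k t) ->
    forall n, m (translate s (O n) `\` translate t (O n)) = 0%E.
Proof.
move=> cL oO Ooo.
have /choice[V hV] (p : nat * nat) : exists V, [/\ open V, V 1 &
    forall s t, (exists2 d, translate d V s & translate d V t) ->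
    (m (translate s (O p.1) `\` translate t (O p.1)) <= p.2.+1%:R^-1%:E)%E].
  have j0 : (0 < p.2.+1%:R^-1 :> R)%R by rewrite invr_gt0.
  have [K [cK KO mK]] := haar_outer_inner_regular hX
    (haar_outer_open hmu (oO p.1)) (Ooo p.1) j0.
  have [U [oU U1 UKO]] := compact_mul_nbhs cK (oO p.1) KO.
  have [V [oV V1 VU]] := group_nbhs_split oU U1.
  exists V; split => // s t [d /translateE ds /translateE dt].
  rewrite -(haar_outer_translate hmu s^-1) translateD translateK.
  apply: le_trans mK; apply: le_outer_measure => x [Ox nOx]; split => // Kx.
  apply: nOx; apply/translateE; apply/translateE; rewrite invgK.
  have [_ _] := VU _ _ dt ds; rewrite invgM invgK -mulgA mulVKg => Uts.
  by rewrite mulgA; exact: UKO.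
have /choice[c hc] (p : nat * nat) : exists c : seq X,
    forall x, L x -> exists2 d, d \in c & translate d (V p) x.
  by have [oV V1 _] := hV p; exact: compact_translates_cover.
(* For each [n] and precision 1/(j+1), [C] lists the members of a finite cover of [L] by translates
   of [V (n, j)]. Only the members containing [s] are used, so the one-sided hypothesis suffices. *)
pose C k :=
  if (choice.unpickle k : option (nat * nat * nat)) is Some (n, j, i) then
    translate (nth 1 (c (n, j)) i) (V (n, j)) else set0.
exists C => s t Ls Cst n; apply/eqP; rewrite eq_le outer_measure_ge0 andbT.
apply/lee_addgt0Pr => e e0; rewrite add0e.
have [j] := ltr_add_invr e0; rewrite add0r => je.
apply: (@le_trans _ _ (j.+1%:R^-1%:E)); last by rewrite lee_fin ltW.
have [d dc ds] := hc (n, j) s Ls.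
have [_ _ ] := hV (n, j); apply; exists d => //.
have := Cst (choice.pickle (n, j, index d (c (n, j)))).
by rewrite /C choice.pickleK nth_index//; apply.
Qed.

(** * Homomorphisms under which preimages of open sets are measurable *)

Section Continuity.
Variables (Y : topGroupType) (h : X -> Y).
Hypothesis hmul : forall x y : X, h (x * y) = h x * h y.
Hypothesis hmeas : forall U : set Y, open U -> m.-caratheodory (h @^-1` U).

Let h1 : h 1 = 1.
Proof. by apply: (@mulgI _ (h 1)); rewrite -hmul !mulg1. Qed.

Let hinv x : h x^-1 = (h x)^-1.
Proof. by apply: (@mulgI _ (h x)); rewrite -hmul !mulgV. Qed.

(** Contrapositive: if this intersection [B] is null, so is [L]. Cutting by quotients of [L] loses
    nothing, since the selected translations [f z] and the points [z] all lie in [L]. *)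
Lemma preimage_nbhs_nonnull (L : set X) (W0 : set Y) :
  compact L -> m L <> 0%E -> open W0 -> W0 1 ->
  m (h @^-1` W0 `&` [set x | exists a b, [/\ L a, L b & x = a^-1 * b]]) <> 0%E.
Proof.
set B := _ `&` _ => cL L0 oW0 W01 B0; apply: L0.
(* Chosen for all sets at once, with a dummy value off the open neighbourhoods of 1, so that it can
   be iterated. *)
have /choice[half hhalf] (V : set Y) : exists W, open V /\ V 1 ->
    [/\ open W, W 1 & forall x y, W x -> W y -> V (x * y) /\ V (x * y^-1)].
  have [[oV V1]|nV] := pselect (open V /\ V 1); last by exists set0 => /nV.
  have [W [oW W1 WV]] := group_nbhs_split oV V1.
  by exists W => _; split => // x y Wx Wy; have [] := WV x y Wx Wy.
pose W n := iter n half W0.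
have W_nbhs n : open (W n) /\ W n 1.
  elim: n => [|n IH]; first by [].
  by have [] := hhalf (W n) IH.
have WM n x y : W n.+1 x -> W n.+1 y -> W n (x * y) /\ W n (x * y^-1).
  by have [_ _] := hhalf (W n) (W_nbhs n); exact.
have WS n x : W n.+1 x -> W n x.
  by move=> Wx; have [+ _] := WM n x 1 Wx (W_nbhs n.+1).2; rewrite mulg1.
(* [V n] is the product of [W 1] up to [W n]; multiplying by one more factor from [W n] still stays
   in [W0]. *)
pose V := fix V n := if n is n'.+1 then
  [set y : Y | exists a b, [/\ V n' a, W n b & y = a * b]] else [set 1].
have VW n a b : V n a -> W n b -> W0 (a * b).
  elim: n a b => [|n IH] a b; first by move=> -> Wb; rewrite mul1g.
  move=> [c [d [Vc Wd ->]]] Wb; rewrite -mulgA; apply: IH => //.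
  by case: (WM n d b).
have [le wole] := @well_ordering_principle X.
have tot : total le.
  by move=> x y; apply: (@wo_chainW _ le predT _ x y) => // A _; exact: wole.
(* With Voo the union of the V n, every x in L lies in E n s for some n, where s
   is the first element of L with Voo (h (s^-1 x)).  Thickening by W n.+2 keeps
   the sets E n s disjoint in s. *)
pose Voo y := exists n, V n y.
pose E n s x := V n (h (s^-1 * x)) /\
  forall t, L t -> t <> s -> le t s -> ~ Voo (h (t^-1 * x)).
pose G n s z := exists x, E n s x /\ W n.+2 (h (x^-1 * z)).
pose F n := L `&` [set z | exists s, L s /\ G n s z].
have G_W0 n s z : G n s z -> W0 (h (s^-1 * z)).
  move=> [x [[Vx _] Wz]]; rewrite -(mulVKg x z) mulgA hmul.
  by apply: (VW n) => //; exact/WS/WS.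
have G_disj n s t z : L s -> L t -> G n s z -> G n t z -> s = t.
  (* A common point [z] would put [h (s'^-1 * y)] in [V n.+1], against the exclusion of earlier
     elements in [E n t' y]. *)
  have aux s' t' : L s' -> G n s' z -> G n t' z -> le s' t' -> s' = t'.
    move=> Ls [x [[Vx _] Wx]] [y [[_ nVy] Wy]] lest.
    apply: contrapT => st; apply: (nVy s') => //; exists n.+1.
    exists (h (s'^-1 * x)), (h (x^-1 * z) * (h (y^-1 * z))^-1).
    split => //; first by case: (WM n.+1 _ _ Wx Wy).
    rewrite -hinv -!hmul; congr h.
    by rewrite invgM invgK -!mulgA !mulVKg.
  move=> Ls Lt Gs Gt; have /orP[lst|lts] := tot s t; first exact: aux.
  exact/esym/aux.
have mG n (S : set X) :
    m.-caratheodory (L `&` [set z | exists s, [/\ S s, L s & G n s z]]).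
  apply: caratheodory_measurable_setI; first exact: haar_outer_compact.
  (* Thickening makes the set the preimage of an open set, whatever the set [S] of indices. *)
  pose U : set Y := \bigcup_(x in [set x | exists s, [/\ S s, L s & E n s x]])
    translate (h x) (W n.+2).
  have -> : [set z | exists s, [/\ S s, L s & G n s z]] = h @^-1` U.
    apply/seteqP; split=> z.
      move=> [s [Ss Ls [x [Ex Wz]]]]; exists x; first by exists s.
      by apply/translateE; rewrite -hinv -hmul.
    move=> [x [s [Ss Ls Ex]] /translateE]; rewrite -hinv -hmul => Wz.
    by exists s; split => //; exists x.
  by apply/hmeas/bigcup_open => x _; apply: translate_open; case: (W_nbhs n.+2).
have FE n (S : set X) : F n `&` [set z | exists s, [/\ S s, L s & G n s z]] =
    L `&` [set z | exists s, [/\ S s, L s & G n s z]].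
  apply/seteqP; split=> z; first by move=> [[Lz _] ?].
  by move=> [Lz [s [Ss Ls Gz]]]; split; [split => //; exists s|exists s].
have L_F : L `<=` \bigcup_n F n.
  (* The least admissible [s] serves, with [z] itself as the point of [E n s]; [T] is nonempty
     because it contains [z]. *)
  move=> z Lz; pose T : {pred X} := [pred t | `[< L t /\ Voo (h (t^-1 * z)) >]].
  have /wole[s [[Ts mins] _]] : wochoice.nonempty T.
    exists z; apply/asboolP; split => //; exists 0%N.
    by rewrite mulVg h1.
  have /asboolP[Ls [n Vn]] := Ts.
  exists n => //; split => //; exists s; split => //; exists z; split.
    split => // t Lt ts lets Vt; apply: ts.
    apply: (@wo_chain_antisymmetric _ le predT _ t s) => //.
      by move=> A _; exact: wole.
    by rewrite lets mins//; apply/asboolP.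
  by rewrite mulVg h1; case: (W_nbhs n.+2).
apply/eqP; rewrite eq_le outer_measure_ge0 andbT.
apply: le_trans (le_outer_measure m _ _ L_F) _.
apply: le_trans (outer_measure_sigma_subadditive m F) _.
rewrite eseries0// => n _ _.
have Foo : (m (F n) < +oo)%E.
  apply: le_lt_trans (haar_outer_compact_lty hX hmu cL).
  by apply: le_outer_measure; exact: subIsetl.
have i0 k : (0 < k.+1%:R^-1 :> R)%R by rewrite invr_gt0.
have /choice[Q hQ] (k : nat) : exists Q : set X,
    [/\ open Q, B `<=` Q & (m Q <= k.+1%:R^-1%:E)%E].
  by have := haar_outer_hull hmu B (i0 k); rewrite B0 add0e.
have oQ k : open (Q k) by case: (hQ k).
have Qoo k : (m (Q k) < +oo)%E.
  by case: (hQ k) => _ _ /le_lt_trans; apply; exact: ltry.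
have [C hC] := countable_translate_code cL oQ Qoo.
have /choice[f hf] z : exists s, F n z -> L s /\ G n s z.
  have [[Lz [s Gs]]|nF] := pselect (F n z); first by exists s.
  by exists 1 => /nF.
pose code s k := `[< C k s >].
pose psi z := code (f z).
have Fpsi P : F n `&` psi @^-1` P =
    L `&` [set z | exists s, [/\ P (code s), L s & G n s z]].
  rewrite -FE; apply/seteqP; split=> z [Fz].
    by move=> Pz; split => //; exists (f z); have [] := hf z Fz.
  move=> [s [Ps Ls Gs]]; split => //; rewrite /= /psi.
  by have [Lf Gf] := hf z Fz; rewrite (G_disj n (f z) s z).
apply: (null_of_null_fibres hX (haar_outer_inner_regular hX (hmu := hmu))
  (psi := psi)) => //.
  by move=> P; rewrite Fpsi; exact: (mG n [set s | P (code s)]).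
move=> c.
have [->|/set0P[z0 [Fz0 cz0]]] := eqVneq (F n `&` psi @^-1` [set c]) set0.
  by rewrite outer_measure0.
(* Over one fibre all selected translations share a code, so they move each [Q k] to the same set
   modulo null sets, and the union of these translates has measure at most that of [Q k]. *)
pose S := [set s | L s /\ code s = c].
have sub k : F n `&` psi @^-1` [set c] `<=` \bigcup_(s in S) translate s (Q k).
  move=> z [Fz cz]; have [Lf Gf] := hf z Fz; exists (f z) => //.
  apply/translateE; have [_ + _] := hQ k; apply; split; first exact: G_W0 Gf.
  by exists (f z), z; split => //; case: Fz.
apply/eqP; rewrite eq_le outer_measure_ge0 andbT.
apply/lee_addgt0Pr => e e0; rewrite add0e.
have [k] := ltr_add_invr e0; rewrite add0r => ke.
apply: (@le_trans _ _ (k.+1%:R^-1%:E)); last by rewrite lee_fin ltW.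
apply: le_trans (le_outer_measure m _ _ (sub k)) _.
have [_ _] := hQ k; apply: le_trans.
apply: (essentially_equal_translates (s0 := f z0)) => // s [Ls cs].
apply: hC => // j Cs; have : code s j = code (f z0) j by rewrite cs -cz0.
by rewrite /code asboolT//; move=> /esym/asboolP.
Qed.

(** Continuity at 1 comes from Steinhaus applied to the preimage of a small neighbourhood,
    intersected with a compact set to make its measure finite; translations carry it to every
    point. *)
Lemma measurable_homomorphism_continuous : continuous h.
Proof.
have [L cL L0] := exists_compact_nonnull hX hmu.
have nbhs1 (W : set Y) : open W -> W 1 ->
    exists V, [/\ open V, V 1 & V `<=` h @^-1` W].
  move=> oW W1; have [W0 [oW0 W01 WW]] := group_nbhs_split oW W1.
  set Q := [set x | exists a b, [/\ L a, L b & x = a^-1 * b]].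
  have cQ : compact Q by exact: compact_quotients.
  have [] := @steinhaus (h @^-1` W0 `&` Q).
  - apply: caratheodory_measurable_setI; first exact: hmeas.
    exact: haar_outer_compact.
  - apply: le_lt_trans (haar_outer_compact_lty hX hmu cQ).
    by apply: le_outer_measure; exact: subIsetr.
  - exact: preimage_nbhs_nonnull.
  move=> V [oV V1 VQ]; exists V; split => // v /VQ[a [b [[Wa _] [Wb _] ->]]].
  by rewrite /= hmul hinv; case: (WW _ _ Wa Wb).
move=> x N; rewrite nbhsE => -[N0 [oN0 N0x] N0N].
have [||V [oV V1 VN]] := nbhs1 (translate (h x)^-1 N0).
- exact: translate_open.
- by apply/translateE; rewrite invgK mulg1.
rewrite nbhs_simpl nbhsE; exists (translate x V).
  by split; [exact: translate_open|apply/translateE; rewrite mulVg].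
move=> z /translateE/VN /translateE; rewrite invgK -hmul mulVKg.
exact: N0N.
Qed.

End Continuity.
End Homomorphisms.

Theorem theorem1p1 (R : realType) (X Y : topGroupType)
    (hX : hausdorff_space X) (lcX : locally_compact [set: X])
    (hY : hausdorff_space Y)
    (h : X -> Y)
    (hmul : forall x y : X, h (monoid.mul x y) = monoid.mul (h x) (h y))
    (hmeas : haar_measurable R h) :
  continuous h.
Proof.
case: hmeas => mu hmu hm.
apply: (measurable_homomorphism_continuous hX (hmu := hmu)) => // U oU.
exact: mu_measurable_caratheodory (hm U oU).
Qed.
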